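(* Let $r\ge 1$ and let $k_1,\dots,k_r,n\in\mathbb{N}=\{1,2,\dots\}$. Then $$\xi_{k_1,\dots,k_r}(n)=\sum_{n_1\ge 1}\frac{\zeta_{n_1}^{\ast}(\{1\}_{n-1})\,\zeta_{n_1-1}(k_2,\dots,k_r)}{n_1^{k_1+1}}.$$ Furthermore, $\xi_{k_1,\dots,k_r}(n)$ can be evaluated into sums of multiple zeta functions, i.e. there is a finite list of tuples $\mathbf{a}^{(1)},\dots,\mathbf{a}^{(M)}$ of positive integers (possibly of different lengths, repetitions allowed), each with first entry at least $2$, such that $\xi_{k_1,\dots,k_r}(n)=\sum_{i=1}^{M}\zeta(\mathbf{a}^{(i)})$.
   Context: The multiple polylogarithm is $\operatorname{Li}_{k_1,\dots,k_r}(z)=\sum_{n_1>n_2>\dots>n_r\ge 1}\frac{z^{n_1}}{n_1^{k_1}n_2^{k_2}\cdots n_r^{k_r}}$ for positive integers $k_1,\dots,k_r$ (convergent for $|z|<1$). The Arakawa–Kaneko function is $$\xi_{k_1,\dots,k_r}(s)=\frac{1}{\Gamma(s)}\int_0^\infty \frac{t^{s-1}}{e^t-1}\operatorname{Li}_{k_1,\dots,k_r}(1-e^{-t})\,dt,\qquad \Re(s)>0.$$ The multiple zeta function (multiple zeta value) is $\zeta(a_1,\dots,a_m)=\sum_{n_1>n_2>\dots>n_m\ge 1}\frac{1}{n_1^{a_1}\cdots n_m^{a_m}}$ for positive integers $a_i$ with $a_1\ge 2$. The finite multiple zeta function is $\zeta_N(a_1,\dots,a_m)=\sum_{N\ge n_1>n_2>\dots>n_m\ge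 1}\frac{1}{n_1^{a_1}\cdots n_m^{a_m}}$, and the finite multiple zeta star function is $\zeta_N^{\ast}(a_1,\dots,a_m)=\sum_{N\ge n_1\ge n_2\ge\dots\ge n_m\ge 1}\frac{1}{n_1^{a_1}\cdots n_m^{a_m}}$, for positive integers $a_i$; an empty sum is $0$ (so $\zeta_0(a_1,\dots,a_m)=0$ for $m\ge1$). With an empty list of arguments ($m=0$) both $\zeta_N$ and $\zeta_N^{\ast}$ equal $1$ for every $N\ge 0$; in particular $\zeta_{n_1-1}(k_2,\dots,k_r)=1$ if $r=1$ and $\zeta^{\ast}_{n_1}(\{1\}_{0})=1$. The notation $\{1\}_{j}$ means $1,\dots,1$ ($j$ entries). *)

(* Defs.v *)
(* MathComp-Analysis *)
From mathcomp Require Import all_boot all_order all_algebra.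
From mathcomp Require Import all_classical all_reals all_analysis.

Set Implicit Arguments.
Unset Strict Implicit.
Unset Printing Implicit Defensive.

Import Order.TTheory GRing.Theory Num.Theory.
Import numFieldNormedType.Exports.

Local Open Scope classical_set_scope.
Local Open Scope ring_scope.

(* Multi-indices bounded by N are tuples over 'I_N.+1, i.e. over {0, ..., N};
   the value 0 is excluded by the two predicates below. *)
Definition index_vals (N m : nat) (n : m.-tuple 'I_N.+1) : seq nat :=
  [seq val i | i <- n].

(* N >= n_1 > n_2 > ... > n_m >= 1 *)
Definition decreasing_index (N m : nat) (n : m.-tuple 'I_N.+1) : bool :=
  sorted gtn (index_vals n) && all (leq 1) (index_vals n).

(* N >= n_1 >= n_2 >= ... >= n_m >= 1 *)
Definition nonincreasing_index (N m : nat) (n : m.-tuple 'I_N.+1) : bool :=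
  sorted geq (index_vals n) && all (leq 1) (index_vals n).

(* 1 / (n_1^a_1 ... n_m^a_m), where m = size a *)
Definition inv_monomial (R : realType) (N : nat) (a : seq nat)
    (n : (size a).-tuple 'I_N.+1) : R :=
  \prod_(i < size a) ((tnth n i)%:R ^+ nth 0%N a i)^-1.

(* For a = [::] the only multi-index is the empty tuple, so that zetaN and
   zetaN_star are both 1, for every N. *)
Definition zetaN (R : realType) (N : nat) (a : seq nat) : R :=
  \sum_(n : (size a).-tuple 'I_N.+1 | decreasing_index n) inv_monomial R n.

Definition zetaN_star (R : realType) (N : nat) (a : seq nat) : R :=
  \sum_(n : (size a).-tuple 'I_N.+1 | nonincreasing_index n) inv_monomial R n.

(* The infinite multiple sums are the limits of their truncations to n_1 <= N;
   limn is meaningful only when these converge, i.e. for a_1 >= 2 in the case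
   of zeta and for |z| < 1 in the case of Li. *)
Definition zeta (R : realType) (a : seq nat) : R :=
  limn (fun N : nat => zetaN R N a).

Definition Li (R : realType) (k : seq nat) (z : R) : R :=
  limn (fun N : nat =>
    \sum_(n : (size k).-tuple 'I_N.+1 | decreasing_index n)
      z ^+ head 0%N (index_vals n) * inv_monomial R n).

(* Gamma and xi are defined here for a real argument s > 0. *)
Definition Gamma (R : realType) (s : R) : R :=
  \int[@lebesgue_measure R]_(t in `]0, +oo[) (t `^ (s - 1) * expR (- t)).

Definition xi (R : realType) (k : seq nat) (s : R) : R :=
  (Gamma s)^-1 *
  \int[@lebesgue_measure R]_(t in `]0, +oo[)
    (t `^ (s - 1) / (expR t - 1) * Li k (1 - expR (- t))).

(* positive entries, the first one at least 2 (hence a <> [::]) *)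
Definition admissible (a : seq nat) : bool :=
  all (leq 1) a && (2 <= head 0 a)%N.

(* Main.v *)
(* Expanding [Li] in powers of [1 - e^-t] and integrating term by term (monotone
   convergence, all terms being nonnegative), the first formula reduces to
     int_0^oo t^(n-1) e^-t (1 - e^-t)^(m-1) dt = (n-1)! zeta*_m({1}_(n-1)) / m,
   which follows by induction on [n] and [m] from the derivative of
   [t^(n-1) e^-t (1 - e^-t)^(m-1)].  For the evaluation, finite multiple zeta
   values are closed under products (stuffle), a star value is a sum of non-star
   ones, and [zeta_m(l, c) = zeta_(m-1)(l, c) + zeta_(m-1)(c) / m^l] turns the
   factor [zeta*_(n1)] into values at [n1 - 1]; every partial sum of the series is
   thereby a fixed finite sum of [zeta_N(a)] with first entry at least 2.  These
   converge because [zeta_N(a) = O(sqrt N)] for every [a]. *)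
Require Import Defs.
From mathcomp Require Import all_boot all_order all_algebra.
From mathcomp Require Import all_classical all_reals all_analysis.
From mathcomp Require Import measurable_realfun ring lra.
Import Order.TTheory GRing.Theory Num.Theory.
Import numFieldNormedType.Exports.
Local Open Scope classical_set_scope.
Local Open Scope ring_scope.

(** * Recursions for the finite sums *)

(** The bijection between nonempty tuples and pairs (head, tail) isolates the largest index. The
    weight [w] lets one statement serve the zeta sums ([w] constant 1) and [Li] ([w j = z ^+ j]). *)
Lemma sum_index_cons {R : realType} (w : nat -> R) (P : pred (seq nat)) (N k : nat)
    (a : seq nat) :
  \sum_(n : (size (k :: a)).-tuple 'I_N.+1 | P (index_vals n))
      w (head 0%N (index_vals n)) * inv_monomial R n =
  \sum_(0 <= j < N.+1) w j / j%:R ^+ k *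
    \sum_(n : (size a).-tuple 'I_N.+1 | P (j :: index_vals n)) inv_monomial R n.
Proof.
rewrite big_mkord.
under [RHS]eq_bigr do rewrite big_distrr.
rewrite pair_big_dep /=.
pose h (p : 'I_N.+1 * (size a).-tuple 'I_N.+1) : (size (k :: a)).-tuple 'I_N.+1 :=
  [tuple of p.1 :: p.2].
rewrite (reindex h) /=; last first.
  exists (fun n => (thead n, [tuple of behead n])) => [[i n]|n] _.
    by rewrite /h /= theadE; congr pair; apply: val_inj.
  by rewrite [RHS]tuple_eta; apply: val_inj.
apply: eq_big => [[i n]//|[i n] _].
rewrite /inv_monomial /= big_ord_recl /= mulrA.
by congr (_ * _); apply: eq_bigr => i' _; rewrite !(tnth_nth ord0).
Qed.

(* [M] plays the role of an outer summation index [n_0]: the remaining indices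
   satisfy [r n_0 n_1], [r n_1 n_2], ..., and are at most [N]. *)
Definition nested_sum (R : realType) (r : rel nat) (N M : nat) (a : seq nat) : R :=
  \sum_(n : (size a).-tuple 'I_N.+1 |
      path r M (index_vals n) && all (leq 1) (index_vals n)) inv_monomial R n.

Lemma nested_sum_nil {R : realType} (r : rel nat) (N M : nat) :
  nested_sum R r N M [::] = 1.
Proof.
rewrite /nested_sum (big_pred1 [tuple]); first by rewrite /inv_monomial big_ord0.
by move=> n; rewrite (tuple0 n) /= eqxx.
Qed.

Lemma nested_sum_cons {R : realType} (r : rel nat) (N M k : nat) (a : seq nat) :
  nested_sum R r N M (k :: a) =
  \sum_(1 <= j < N.+1 | r M j) nested_sum R r N j a / j%:R ^+ k.
Proof.
have := @sum_index_cons R (fun=> 1) (fun s => path r M s && all (leq 1) s) N k a.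
rewrite /nested_sum; under eq_bigr do rewrite mul1r.
(* The term [j = 0] is an empty sum, because [all (leq 1)] rejects it. *)
move=> ->; rewrite big_nat_recl //= [X in X + _](_ : _ = 0) ?add0r; last first.
  by rewrite big_pred0 ?mulr0// => n; rewrite andbF.
rewrite big_add1 /= [RHS]big_mkcond /=; apply: eq_bigr => j _.
case: ifP => _; last by rewrite big_pred0 ?mulr0.
by rewrite mul1r mulrC.
Qed.

(** By transitivity every index of the tuple is related to [M], so both bounds hold automatically.
    This is what lowers the bound [N], left on the inner sum by [nested_sum_cons], to the one in
    [zetaN R j.-1] or [zetaN_star R j]. *)
Lemma nested_sum_bound {R : realType} (r : rel nat) (a : seq nat) (M N N' : nat) :
  transitive r -> (forall j, r M j -> (j <= N)%N) -> (forall j, r M j -> (j <= N')%N) ->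
  nested_sum R r N M a = nested_sum R r N' M a.
Proof.
move=> tr; elim: a M N N' => [|k a IH] M N N' HN HN'; first by rewrite !nested_sum_nil.
rewrite !nested_sum_cons.
(* Both sides are compared with one sum running up to [maxn N N']. *)
have wid K : (forall j, r M j -> (j <= K)%N) ->
    \sum_(1 <= j < K.+1 | r M j) nested_sum R r K j a / j%:R ^+ k =
    \sum_(1 <= j < (maxn N N').+1 | r M j) nested_sum R r N j a / j%:R ^+ k.
  move=> HK.
  transitivity (\sum_(1 <= j < (maxn K (maxn N N')).+1 | r M j)
      nested_sum R r N j a / j%:R ^+ k); last first.
    rewrite [RHS](@big_nat_widen _ _ _ 1 _ (maxn K (maxn N N')).+1); last first.
      by rewrite ltnS leq_maxr.
    apply: eq_bigl => j; case rMj: (r M j) => //=.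
    by rewrite ltnS leq_max HN.
  rewrite (@big_nat_widen _ _ _ 1 _ (maxn K (maxn N N')).+1); last first.
    by rewrite ltnS leq_maxl.
  apply: eq_big => j.
    by case rMj: (r M j) => //=; rewrite ltnS HK.
  move=> /andP[rMj _]; congr (_ / _); apply: IH => i rji.
    exact/HK/(tr j).
  exact/HN/(tr j).
by rewrite wid // wid.
Qed.

(** The fictitious outer index is [N.+1] because [gtn] is strict; for the star sums it is [N]. *)
Lemma zetaN_nested {R : realType} (N : nat) (a : seq nat) :
  zetaN R N a = nested_sum R gtn N N.+1 a.
Proof.
apply: eq_bigl => n; rewrite /decreasing_index /index_vals.
by case: (tval n) => //= i s; have -> : (val i < N.+1)%N := ltn_ord i.
Qed.

Lemma zetaN_star_nested {R : realType} (N : nat) (a : seq nat) :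
  zetaN_star R N a = nested_sum R geq N N a.
Proof.
apply: eq_bigl => n; rewrite /nonincreasing_index /index_vals.
by case: (tval n) => //= i s; have -> : (val i <= N)%N := ltn_ord i.
Qed.

Lemma zetaN_nil {R : realType} (N : nat) : zetaN R N [::] = 1.
Proof. by rewrite zetaN_nested nested_sum_nil. Qed.

Lemma zetaN_cons {R : realType} (N k : nat) (a : seq nat) :
  zetaN R N (k :: a) = \sum_(1 <= j < N.+1) zetaN R j.-1 a / j%:R ^+ k.
Proof.
rewrite zetaN_nested nested_sum_cons big_nat_cond [RHS]big_nat_cond.
apply: eq_big => [j|[//|j]].
  by case: (boolP (0 < j < N.+1)%N) => //= /andP[_ jN]; exact: jN.
move=> /andP[/andP[_ jN] _].
rewrite zetaN_nested; congr (_ / _); apply: nested_sum_bound => //=.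
  by move=> x y z /= xy zx; apply: ltn_trans zx xy.
by move=> i ij; apply: leq_trans (ltnW ij) _.
Qed.

Lemma zetaN_star_nil {R : realType} (N : nat) : zetaN_star R N [::] = 1.
Proof. by rewrite zetaN_star_nested nested_sum_nil. Qed.

Lemma zetaN_star_cons {R : realType} (N k : nat) (a : seq nat) :
  zetaN_star R N (k :: a) = \sum_(1 <= j < N.+1) zetaN_star R j a / j%:R ^+ k.
Proof.
rewrite zetaN_star_nested nested_sum_cons big_nat_cond [RHS]big_nat_cond.
apply: eq_big => j.
  by case: (boolP (0 < j < N.+1)%N) => //= /andP[_ jN]; exact: jN.
move=> /andP[/andP[_ jN] _].
rewrite zetaN_star_nested; congr (_ / _); apply: nested_sum_bound => //=.
  by move=> x y z /= xy zx; apply: leq_trans zx xy.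
by move=> i ij; apply: leq_trans ij _.
Qed.

Lemma Li_cons {R : realType} (k : nat) (a : seq nat) (z : R) :
  Li (k :: a) z = limn (fun N => \sum_(1 <= j < N.+1) z ^+ j * (zetaN R j.-1 a / j%:R ^+ k)).
Proof.
rewrite /Li; congr (limn _); apply/funext => N.
rewrite (sum_index_cons (fun j => z ^+ j) (fun s => sorted gtn s && all (leq 1) s)).
rewrite big_nat_recl //= [X in X + _](_ : _ = 0) ?add0r; last first.
  by rewrite big_pred0 ?mulr0// => n; rewrite andbF.
rewrite big_add1 /= big_nat_cond [RHS]big_nat_cond; apply: eq_bigr => j /andP[jN _].
rewrite -mulrA; congr (_ * _); rewrite mulrC; congr (_ / _).
rewrite zetaN_nested /=; apply: nested_sum_bound => //=.
  by move=> x y w /= xy wx; apply: ltn_trans wx xy.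
by move=> i ij; apply: leq_trans (ij : (i <= j)%N) (ltnW jN).
Qed.

(** * Sums of multiple zeta values *)

(** The list [L] is independent of [N], so such an identity survives the limit; multiplicities are
    repetitions in [L], and [P] will be positivity or admissibility of the tuples. *)
Definition zeta_comb {R : realType} (P : pred (seq nat)) (f : nat -> R) : Prop :=
  exists L : seq (seq nat), all P L /\ forall N, f N = \sum_(a <- L) zetaN R N a.

Lemma zeta_comb_zetaN {R : realType} (P : pred (seq nat)) (a : seq nat) :
  P a -> zeta_comb P (fun N => zetaN R N a).
Proof. by move=> Pa; exists [:: a]; rewrite /= Pa; split=> // N; rewrite big_seq1. Qed.

Lemma zeta_comb_sum {R : realType} (P : pred (seq nat)) (I : eqType) (s : seq I)
    (f : I -> nat -> R) :
  {in s, forall i, zeta_comb P (f i)} -> zeta_comb P (fun N => \sum_(i <- s) f i N).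
Proof.
elim: s => [|i s IH] Hs; first by exists [::]; split=> // N; rewrite !big_nil.
have [|L1 [PL1 EL1]] := Hs i; first exact: mem_head.
have [|L2 [PL2 EL2]] := IH; first by move=> j js; apply: Hs; rewrite inE js orbT.
exists (L1 ++ L2); rewrite all_cat PL1 PL2; split=> // N.
by rewrite big_cons big_cat /= EL1 EL2.
Qed.

Lemma zeta_combD {R : realType} (P : pred (seq nat)) (f g : nat -> R) :
  zeta_comb P f -> zeta_comb P g -> zeta_comb P (fun N => f N + g N).
Proof.
move=> Hf Hg.
have := @zeta_comb_sum R P _ [:: true; false] (fun b : bool => if b then f else g).
move=> []; first by case.
move=> L [PL EL]; exists L; split=> // N.
by rewrite -EL !big_cons big_nil addr0.
Qed.

Lemma zeta_comb_nested {R : realType} (P Q : pred (seq nat)) (k : nat) (f : nat -> R) :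
  (forall a, P a -> Q (k :: a)) -> zeta_comb P f ->
  zeta_comb Q (fun N => \sum_(1 <= j < N.+1) f j.-1 / j%:R ^+ k).
Proof.
move=> PQ [L [PL EL]]; exists (map (cons k) L); split.
  by rewrite all_map; apply: sub_all PL.
move=> N; under eq_bigr do rewrite EL mulr_suml.
by rewrite exchange_big big_map; apply: eq_bigr => a _; rewrite zetaN_cons.
Qed.

(** The pairs of indices are grouped by their maximum [j], reached by the second index, the first,
    or both: these are the three terms of the stuffle product. *)
Lemma mul_partial_sums {R : realType} (u v : nat -> R) (N : nat) :
  (\sum_(1 <= j < N.+1) u j) * (\sum_(1 <= j < N.+1) v j) =
  \sum_(1 <= j < N.+1) ((\sum_(1 <= i < j.-1.+1) u i) * v j +
    u j * (\sum_(1 <= i < j.-1.+1) v i) + u j * v j).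
Proof.
elim: N => [|N IH]; first by rewrite !big_geq // mul0r.
rewrite ![\sum_(1 <= j < N.+2) _]big_nat_recr //= -IH; ring.
Qed.

Definition pos_index : pred (seq nat) := all (leq 1).

Lemma zetaN_stuffle {R : realType} (a b : seq nat) : pos_index a -> pos_index b ->
  zeta_comb pos_index (fun N => zetaN R N a * zetaN R N b).
Proof.
have [m] := ubnP (size a + size b); elim: m a b => // m IH [|k a] [|l b] sz Ha Hb.
- have [|L [PL EL]] := @zeta_comb_zetaN R pos_index [::]; first by [].
  by exists L; split=> // N; rewrite -EL zetaN_nil mulr1.
- have [L [PL EL]] := @zeta_comb_zetaN R pos_index _ Hb.
  by exists L; split=> // N; rewrite -EL zetaN_nil mul1r.
- have [L [PL EL]] := @zeta_comb_zetaN R pos_index _ Ha.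
  by exists L; split=> // N; rewrite -EL zetaN_nil mulr1.
have /andP[k1 Ha'] := Ha; have /andP[l1 Hb'] := Hb.
have cl p : (0 < p)%N -> forall c, pos_index c -> pos_index (p :: c).
  by move=> p1 c Hc; rewrite /pos_index /= p1.
rewrite /= ltnS addSn addnS in sz.
(* The three products left after removing the largest index, which carries exponent [l], [k] and
   [k + l] respectively; each has smaller total length. *)
have C1 : zeta_comb pos_index (fun N => zetaN R N (k :: a) * zetaN R N b).
  by apply: IH => //=; rewrite addSn.
have C2 : zeta_comb pos_index (fun N => zetaN R N a * zetaN R N (l :: b)).
  by apply: IH => //=; rewrite addnS.
have C3 : zeta_comb pos_index (fun N => zetaN R N a * zetaN R N b).
  by apply: IH => //=; apply: ltnW.
have [L [PL EL]] := zeta_combD _ _ _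
  (zeta_combD _ _ _ (zeta_comb_nested _ _ l _ (cl l l1) C1)
     (zeta_comb_nested _ _ k _ (cl k k1) C2))
  (zeta_comb_nested _ _ (k + l) _ (cl (k + l)%N (leq_trans k1 (leq_addr _ _))) C3).
exists L; split=> // N; rewrite -EL !zetaN_cons mul_partial_sums -!big_split /=.
rewrite [LHS]big_nat_cond [RHS]big_nat_cond.
apply: eq_bigr => j /andP[/andP[j0 _] _]; rewrite -!zetaN_cons exprD invfM.
ring.
Qed.

Lemma zeta_combM {R : realType} (f g : nat -> R) :
  zeta_comb pos_index f -> zeta_comb pos_index g ->
  zeta_comb pos_index (fun N => f N * g N).
Proof.
move=> [K [PK EK]] [L [PL EL]].
have [|M [PM EM]] := @zeta_comb_sum R pos_index _ K
  (fun a N => \sum_(b <- L) zetaN R N a * zetaN R N b).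
  move=> a aK; apply: zeta_comb_sum => b bL; apply: zetaN_stuffle.
    exact: (allP PK).
  exact: (allP PL).
exists M; split=> // N; rewrite -EM EK EL mulr_suml.
by apply: eq_bigr => a _; rewrite mulr_sumr.
Qed.

(* [f j.-1] is only meaningful for [0 < j]. *)
Lemma zeta_comb_shift {R : realType} (f : nat -> R) : zeta_comb pos_index f ->
  exists L : seq (nat * seq nat), all (pos_index \o snd) L /\
    forall j, (0 < j)%N -> f j = \sum_(p <- L) zetaN R j.-1 p.2 / j%:R ^+ p.1.
Proof.
move=> [L [PL EL]].
(* The pair [(0, a)] stands for the indices below [j]; the pair [(l, c)] stands for those whose
   first entry equals [j]. *)
exists (flatten [seq (0, a) :: (if a is l :: c then [:: (l, c)] else [::]) | a <- L]).
split.
  apply/allP => p /flattenP[s /mapP[a aL ->]]; have := allP PL _ aL.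
  case: a {aL} => [_|l c Hlc] /=; rewrite !inE; first by move=> /eqP ->.
  by case/orP => /eqP -> //=; case/andP: Hlc.
move=> [//|j] _; rewrite EL big_flatten big_map; apply: eq_bigr => a _.
case: a => [|l c]; rewrite !big_cons big_nil /= addr0 expr0 divr1.
  by rewrite !zetaN_nil.
by rewrite !zetaN_cons [LHS]big_nat_recr.
Qed.

(** Rewriting [f j] through values at [j.-1] costs extra powers [p] of [1 / j], after which the
    stuffle product applies at the common bound [j.-1]. It serves both the star values and the
    series for [xi]. *)
Lemma zeta_comb_nested_star {R : realType} (Q : pred (seq nat)) (k : nat)
    (f g : nat -> R) :
  (forall p a, pos_index a -> Q ((p + k)%N :: a)) ->
  zeta_comb pos_index f -> zeta_comb pos_index g ->
  zeta_comb Q (fun N => \sum_(1 <= j < N.+1) f j * g j.-1 / j%:R ^+ k).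
Proof.
move=> HQ /zeta_comb_shift[K [PK EK]] Hg.
have [|L [PL EL]] := @zeta_comb_sum R Q _ K (fun p N =>
    \sum_(1 <= j < N.+1) (zetaN R j.-1 p.2 * g j.-1) / j%:R ^+ (p.1 + k)).
  move=> p pK; apply: (zeta_comb_nested pos_index _ _
    (fun N => zetaN R N p.2 * g N)) => //; first exact: HQ.
  by apply: zeta_combM => //; apply: zeta_comb_zetaN; exact: (allP PK _ pK).
exists L; split=> // N; rewrite -EL exchange_big [LHS]big_nat_cond [RHS]big_nat_cond.
apply: eq_bigr => j /andP[/andP[j0 _] _]; rewrite EK // !mulr_suml.
by apply: eq_bigr => p _; rewrite exprD invfM; ring.
Qed.

Lemma zeta_comb_star {R : realType} (a : seq nat) : pos_index a ->
  zeta_comb pos_index (fun N => zetaN_star R N a).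
Proof.
elim: a => [_|k a IH /andP[k1 Ha]].
  have [|L [PL EL]] := @zeta_comb_zetaN R pos_index [::]; first by [].
  by exists L; split=> // N; rewrite -EL zetaN_nil zetaN_star_nil.
(* The second factor is the empty value, which is 1. *)
have [|||L [PL EL]] := @zeta_comb_nested_star R pos_index k
  (fun N => zetaN_star R N a) (fun N => zetaN R N [::]).
- by move=> p c Hc; apply/andP; split=> //; exact: leq_trans k1 (leq_addl _ _).
- exact: IH.
- exact: zeta_comb_zetaN.
exists L; split=> // N; rewrite -EL zetaN_star_cons.
by apply: eq_bigr => j _; rewrite zetaN_nil mulr1.
Qed.

(** * Convergence *)

Lemma zetaN_ge0 {R : realType} (N : nat) (a : seq nat) : 0 <= zetaN R N a.
Proof.
apply: sumr_ge0 => n _; apply: prodr_ge0 => i _.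
by rewrite invr_ge0 exprn_ge0 // ler0n.
Qed.

Lemma zetaN_nondecreasing {R : realType} (a : seq nat) :
  nondecreasing_seq (fun N => zetaN R N a).
Proof.
apply/nondecreasing_seqP => N; case: a => [|k a]; first by rewrite !zetaN_nil.
rewrite !zetaN_cons [leRHS]big_nat_recr //= lerDl.
by rewrite divr_ge0 ?zetaN_ge0 // exprn_ge0 // ler0n.
Qed.

Lemma sqrt_natS {R : realType} (N : nat) (s := Num.sqrt N.+1%:R : R)
    (u := Num.sqrt N%:R : R) : [/\ 0 < s, 0 <= u & s * s = u * u + 1].
Proof.
split; rewrite ?sqrtr_gt0 ?sqrtr_ge0 ?ltr0n //.
by rewrite -!expr2 !sqr_sqrtr ?ler0n // -natr1.
Qed.

Lemma sum_inv_sqrt_le {R : realType} (N : nat) :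
  \sum_(1 <= j < N.+1) (Num.sqrt j%:R : R)^-1 <= 2 * Num.sqrt N%:R.
Proof.
elim: N => [|N IH]; first by rewrite big_geq // mulr_ge0 // sqrtr_ge0.
rewrite big_nat_recr //=; apply: le_trans (lerD IH (lexx _)) _.
have [s0 u0 suE] := @sqrt_natS R N.
rewrite -lerBrDl -[_^-1]mul1r ler_pdivrMr //.
move: s0 u0 suE; set s := Num.sqrt _; set u := Num.sqrt _ => s0 u0 suE.
(* Since [s * s - u * u = 1], the goal [1 <= 2 s (s - u)] is [(s - u)^2 >= 0]. *)
have := sqr_ge0 (s - u); nra.
Qed.

Lemma sum_inv_sqrt3_le {R : realType} (N : nat) :
  \sum_(1 <= j < N.+1) (Num.sqrt j%:R * j%:R : R)^-1 <= 3.
Proof.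
case: N => [|N]; first by rewrite big_geq.
(* The bound is strengthened so that induction telescopes: [2 / sqrt x] decreases by at least
   [(x + 1)^(-3/2)] from [x] to [x + 1]. *)
suff : \sum_(1 <= j < N.+2) (Num.sqrt j%:R * j%:R : R)^-1
    <= 3 - 2 / Num.sqrt N.+1%:R.
  by move=> /le_trans; apply; rewrite gerBl divr_ge0 // sqrtr_ge0.
elim: N => [|N IH].
  rewrite big_nat1 mulr1 sqrtr1 divr1 invr1; lra.
rewrite big_nat_recr //=; apply: le_trans (lerD IH (lexx _)) _.
have [s0 _ suE] := @sqrt_natS R N.+1; have [u0 _ _] := @sqrt_natS R N.
have -> : N.+2%:R = Num.sqrt N.+2%:R * Num.sqrt N.+2%:R :> R.
  by rewrite -expr2 sqr_sqrtr ?ler0n.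
rewrite [Num.sqrt (_ * _)](_ : _ = Num.sqrt N.+2%:R); last first.
  by rewrite -expr2 sqrtr_sqr ger0_norm // sqrtr_ge0.
move: s0 u0 suE; set s := Num.sqrt _; set u := Num.sqrt _ => s0 u0 suE.
rewrite -subr_ge0.
have -> : 3 - 2 / s - (3 - 2 / u + (s * (s * s))^-1) =
    (2 * (s * s) * (s - u) - u) / (s * (s * s) * u).
  by field; rewrite !gt_eqF.
apply: divr_ge0; last by rewrite !mulr_ge0 // ltW.
have us : u <= s by nra.
(* As above, [2 s (s - u) - 1 = (s - u)^2]; hence [2 s^2 (s - u) >= s >= u]. *)
have : s * (2 * (s * (s - u)) - 1) >= 0.
  apply: mulr_ge0; first exact: ltW.
  have := sqr_ge0 (s - u); nra.
nra.
Qed.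

(** The inductive bound on the inner sum is a multiple of [sqrt j], which turns [1 / j] into
    [1 / sqrt j]; summing these costs a factor 2 per entry. The root of [N.+1] also covers the empty
    index at [N = 0]. *)
Lemma zetaN_le_sqrt {R : realType} (N : nat) (a : seq nat) : pos_index a ->
  zetaN R N a <= 2 ^+ size a * Num.sqrt N.+1%:R.
Proof.
elim: a N => [|k a IH] N.
  by move=> _; rewrite zetaN_nil mul1r -{1}sqrtr1 ler_wsqrtr // ler1n.
move=> /andP[k1 Ha]; rewrite zetaN_cons /=.
apply: (@le_trans _ _ (2 ^+ size a * \sum_(1 <= j < N.+1) (Num.sqrt j%:R : R)^-1)).
  rewrite mulr_sumr !big_nat; apply: ler_sum => -[//|j] /andP[_ jN].
  have [s0 _ _] := @sqrt_natS R j.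
  have sE : j.+1%:R = Num.sqrt j.+1%:R * Num.sqrt j.+1%:R :> R.
    by rewrite -expr2 sqr_sqrtr ?ler0n.
  apply: (@le_trans _ _ (zetaN R j a / j.+1%:R)).
    rewrite ler_wpM2l ?zetaN_ge0 // lef_pV2 ?posrE ?exprn_gt0 ?ltr0n //.
    by rewrite -[leLHS]expr1 ler_weXn2l // ler1n.
  rewrite ler_pdivrMr ?ltr0n // [X in _ * _ * X]sE mulrA divfK ?gt_eqF //.
  exact: IH.
rewrite exprSr -mulrA ler_wpM2l ?exprn_ge0 //.
apply: le_trans (sum_inv_sqrt_le _) _.
by rewrite ler_wpM2l // ler_wsqrtr // ler_nat.
Qed.

(** With first exponent at least 2, the square-root growth of the inner sum leaves [j^(-3/2)], whose
    sums stay below 3. *)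
Lemma zetaN_admissible_le {R : realType} (N : nat) (a : seq nat) : admissible a ->
  zetaN R N a <= 2 ^+ size a * 3.
Proof.
case: a => [//|k a] /andP[/andP[_ Ha] /= k2]; rewrite zetaN_cons /=.
apply: (@le_trans _ _
  (2 ^+ size a * \sum_(1 <= j < N.+1) (Num.sqrt j%:R * j%:R : R)^-1)).
  rewrite mulr_sumr !big_nat; apply: ler_sum => -[//|j] /andP[_ jN].
  have [s0 _ _] := @sqrt_natS R j.
  have sE : j.+1%:R ^+ 2 = Num.sqrt j.+1%:R * j.+1%:R * Num.sqrt j.+1%:R :> R.
    by rewrite mulrAC -[_ * Num.sqrt _]expr2 sqr_sqrtr ?ler0n.
  apply: (@le_trans _ _ (zetaN R j a / j.+1%:R ^+ 2)).
    rewrite ler_wpM2l ?zetaN_ge0 // lef_pV2 ?posrE ?exprn_gt0 ?ltr0n //.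
    by rewrite ler_weXn2l // ler1n.
  rewrite ler_pdivrMr ?exprn_gt0 ?ltr0n // sE mulrA.
  rewrite divfK ?mulf_neq0 ?gt_eqF ?ltr0n //; exact: zetaN_le_sqrt.
rewrite ler_pM ?exprn_ge0 ?sum_inv_sqrt3_le //.
  by apply: sumr_ge0 => j _; rewrite invr_ge0 mulr_ge0 ?sqrtr_ge0 ?ler0n.
by rewrite ler_weXn2l // ler1n.
Qed.

Lemma cvg_zetaN {R : realType} (a : seq nat) : admissible a ->
  zetaN R N a @[N --> \oo] --> zeta R a.
Proof.
move=> Ha; apply: nondecreasing_is_cvgn; first exact: zetaN_nondecreasing.
by exists (2 ^+ size a * 3) => _ [N _ <-]; exact: zetaN_admissible_le.
Qed.

Lemma cvg_zeta_comb {R : realType} (f : nat -> R) : zeta_comb admissible f ->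
  exists L : seq (seq nat), all admissible L /\
    f N @[N --> \oo] --> \sum_(a <- L) zeta R a.
Proof.
move=> [L [PL EL]]; exists L; split=> //; rewrite (funext EL).
elim: L PL {EL} => [_|a L IH /andP[Pa PL]].
  by rewrite big_nil; under eq_fun do rewrite big_nil; exact: cvg_cst.
rewrite big_cons; under eq_fun do rewrite big_cons.
by apply: cvgD; [exact: cvg_zetaN | exact: IH].
Qed.

Lemma sum_natmul_expr_le {R : realType} (z : R) (N : nat) : 0 <= z < 1 ->
  \sum_(1 <= j < N.+1) j%:R * z ^+ j <= z / (1 - z) ^+ 2.
Proof.
move=> /andP[z0 z1]; have z10 : 0 < 1 - z by rewrite subr_gt0.
rewrite ler_pdivlMr ?exprn_gt0 //.
(* Exact closed form of the truncated series; the subtracted term is nonnegative. *)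
have -> : (\sum_(1 <= j < N.+1) j%:R * z ^+ j) * (1 - z) ^+ 2 =
    z - z ^+ N.+1 * (N%:R * (1 - z) + 1).
  elim: N => [|N IH]; first by rewrite big_geq // mul0r expr1; ring.
  rewrite big_nat_recr //= mulrDl IH -!natr1 !exprS; ring.
by rewrite gerBl mulr_ge0 ?exprn_ge0 // addr_ge0 // mulr_ge0 ?ler0n // ltW.
Qed.

(** The coefficients are at most [2 ^+ size a * sqrt j], hence at most a constant times [j], so the
    increasing partial sums are dominated by those of [j z^j]. *)
Lemma cvg_Li {R : realType} (k : nat) (a : seq nat) (z : R) : pos_index a -> 0 <= z < 1 ->
  \sum_(1 <= j < N.+1) z ^+ j * (zetaN R j.-1 a / j%:R ^+ k) @[N --> \oo]
    --> Li (k :: a) z.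
Proof.
move=> Ha z01; have /andP[z0 z1] := z01.
have t0 j : 0 <= z ^+ j * (zetaN R j.-1 a / j%:R ^+ k).
  by rewrite mulr_ge0 ?exprn_ge0 // divr_ge0 ?zetaN_ge0 ?exprn_ge0 ?ler0n.
rewrite Li_cons; apply: nondecreasing_is_cvgn.
  by apply/nondecreasing_seqP => N; rewrite [leRHS]big_nat_recr //= lerDl.
exists (2 ^+ size a * (z / (1 - z) ^+ 2)) => _ [N _ <-].
apply: (@le_trans _ _ (2 ^+ size a * \sum_(1 <= j < N.+1) j%:R * z ^+ j)); last first.
  by rewrite ler_wpM2l ?exprn_ge0 // sum_natmul_expr_le.
rewrite mulr_sumr !big_nat; apply: ler_sum => -[//|j] _.
rewrite [leRHS]mulrA [leLHS]mulrC ler_wpM2r ?exprn_ge0 //=.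
apply: (@le_trans _ _ (zetaN R j a)).
  rewrite ler_piMr ?zetaN_ge0 // invf_le1 ?exprn_gt0 ?ltr0n //.
  by rewrite exprn_ege1 // ler1n.
apply: le_trans (zetaN_le_sqrt _ _ Ha) _; rewrite ler_wpM2l ?exprn_ge0 //.
have [s0 _ _] := @sqrt_natS R j.
have s1 : 1 <= Num.sqrt j.+1%:R :> R by rewrite -{1}sqrtr1 ler_wsqrtr // ler1n.
by rewrite -[leRHS]sqr_sqrtr ?ler0n // expr2 ler_peMl // ltW.
Qed.

(** * The integrals over the half-line *)

Lemma is_derive_mul {R : realType} {f g : R -> R} {t df dg : R} :
  is_derive t 1 f df -> is_derive t 1 g dg ->
  is_derive t 1 (fun x => f x * g x) (df * g t + f t * dg).
Proof.
move=> Hf Hg; apply: (is_derive_eq (is_deriveM Hf Hg)).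
by rewrite /GRing.scale /= addrC [g t * _]mulrC.
Qed.

Lemma is_derive_exp {R : realType} {f : R -> R} (n : nat) {t df : R} :
  is_derive t 1 f df -> is_derive t 1 (fun x => f x ^+ n) (n%:R * f t ^+ n.-1 * df).
Proof.
by move=> Hf; rewrite -[fun x => _]/(fun x => f x ^+ n) -exprfctE; exact: is_deriveX.
Qed.

Lemma is_derive_expRN {R : realType} (t : R) :
  is_derive t 1 (fun x => expR (- x)) (- expR (- t)).
Proof.
have := @is_derive1_comp R expR -%R t _ _ (is_derive_expR (- t)) (is_deriveNid _ _).
by rewrite mulrN1.
Qed.

Lemma is_derive_1BexpRN {R : realType} (t : R) :
  is_derive t 1 (fun x => 1 - expR (- x)) (expR (- t)).
Proof.
have := is_deriveB (is_derive_cst (1 : R) t 1) (is_derive_expRN t).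
by rewrite sub0r opprK.
Qed.

(* As [G] vanishes at infinity, [v = - G 0] is the integral of [f] over the
   half-line. Carrying [G] along instead of the integral makes integrability
   questions disappear. *)
Definition has_primitive0y {R : realType} (f : R -> R) (v : R) : Prop :=
  exists G : R -> R, [/\ forall t : R, is_derive t 1 G (f t),
    G t @[t --> +oo] --> 0 & G 0 = - v].

Lemma has_primitive0yD {R : realType} {f g : R -> R} {v w : R} :
  has_primitive0y f v -> has_primitive0y g w ->
  has_primitive0y (fun t => f t + g t) (v + w).
Proof.
move=> [F [dF F0 Fv]] [G [dG G0 Gw]]; exists (F \+ G); split.
- by move=> t; exact: is_deriveD.
- by rewrite -[0]addr0; exact: cvgD.
- by rewrite /= Fv Gw opprD.
Qed.

Lemma has_primitive0yZ {R : realType} (c : R) {f : R -> R} {v : R} :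
  has_primitive0y f v -> has_primitive0y (fun t => c * f t) (c * v).
Proof.
move=> [F [dF F0 Fv]]; exists (fun t => c * F t); split.
- move=> t; have := is_derive_mul (is_derive_cst c t 1) (dF t).
  by rewrite mul0r add0r.
- by rewrite -(mulr0 c); exact: cvgMr.
- by rewrite Fv mulrN.
Qed.

Lemma has_primitive0y_sum {R : realType} (s : seq nat) (f : nat -> R -> R) (v : nat -> R) :
  (forall i, has_primitive0y (f i) (v i)) ->
  has_primitive0y (fun t => \sum_(i <- s) f i t) (\sum_(i <- s) v i).
Proof.
move=> H; elim: s => [|i s IH].
  rewrite big_nil; under eq_fun do rewrite big_nil.
  exists (cst 0); split; [|exact: cvg_cst|by rewrite oppr0].
  by move=> t; exact: is_derive_cst.
rewrite big_cons; under eq_fun do rewrite big_cons.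
exact: has_primitive0yD.
Qed.

(** The fundamental theorem of calculus on the half-line for nonnegative functions; the endpoint 0
    can be added as a null set. *)
Lemma integral_has_primitive0y {R : realType} (f : R -> R) (v : R) :
  continuous f -> (forall t, 0 <= t -> 0 <= f t) -> has_primitive0y f v ->
  (\int[@lebesgue_measure R]_(t in `]0%R, +oo[) (f t)%:E = v%:E)%E.
Proof.
move=> cf f0 [G [dG G0 Gv]].
rewrite integral_itv_obnd_cbnd; last first.
  apply/measurable_EFinP/measurable_funTS.
  exact: continuous_measurable_fun.
rewrite (@ge0_continuous_FTC2y _ f G 0 0) //.
- by rewrite Gv EFinN oppeK add0e.
- exact: continuous_subspaceT.
- apply: cvg_at_right_filter; apply: differentiable_continuous.
  by apply/derivable1_diffP; have [] := dG 0.
- by move=> t _; rewrite derive1E; exact: derive_val.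
Qed.

(* The substitution [u = 1 - expR (- t)] turns it into [u ^+ m * (- ln (1 - u)) ^+ n]. *)
Definition log_moment {R : realType} (n m : nat) (t : R) : R :=
  t ^+ n * (expR (- t) * (1 - expR (- t)) ^+ m).

Lemma expRN_itv {R : realType} {t : R} : 0 <= t -> 0 <= 1 - expR (- t) < 1.
Proof.
move=> t0; rewrite ltrBlDr ltrDl expR_gt0 andbT subr_ge0.
by rewrite -expR0 ler_expR oppr_le0.
Qed.

Lemma log_moment_ge0 {R : realType} (n m : nat) (t : R) : 0 <= t -> 0 <= log_moment n m t.
Proof.
move=> t0; have /andP[u0 _] := expRN_itv t0.
by rewrite !mulr_ge0 ?exprn_ge0 ?expR_ge0.
Qed.

(* For [m = 0] the meaningless index [m.-1] is multiplied by [0]. *)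
Lemma is_derive_log_moment {R : realType} (n m : nat) (t : R) :
  is_derive t 1 (log_moment n.+1 m)
    (n.+1%:R * log_moment n m t + m%:R * log_moment n.+1 m.-1 t
     - m.+1%:R * log_moment n.+1 m t).
Proof.
have d1 := is_derive_mul (is_derive_expRN t) (is_derive_exp m (is_derive_1BexpRN t)).
have := is_derive_mul (is_derive_exp n.+1 (is_derive_id t 1)) d1.
move=> /is_derive_eq; apply; rewrite /log_moment /=.
case: m {d1} => [|m] /=; rewrite -?natr1 ?exprS; ring.
Qed.

Lemma continuous_log_moment {R : realType} (n m : nat) : continuous (@log_moment R n m).
Proof.
move=> t; apply: differentiable_continuous; apply/derivable1_diffP.
have d1 := is_derive_mul (is_derive_expRN t) (is_derive_exp m (is_derive_1BexpRN t)).
by have [] := is_derive_mul (is_derive_exp n (is_derive_id t 1)) d1.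
Qed.

(** From [expR t >= 1 + t^(n+1) / (n+1)!] follows [t^(n+1) expR (- t) <= (n+1)!], so the function is
    at most [(n+1)! / t]. *)
Lemma cvgy_log_moment {R : realType} (n m : nat) :
  @log_moment R n m t @[t --> +oo] --> 0.
Proof.
apply: (@squeeze_cvgr _ _ _ _ (cst 0) (fun t => n.+1`!%:R * t^-1)).
- near=> t; have t0 : 0 < t by near: t; exact: nbhs_pinfty_gt.
  rewrite log_moment_ge0 ?(ltW t0) //= ler_pdivlMr // /log_moment.
  have /andP[u0 /ltW u1] := expRN_itv (ltW t0).
  apply: (@le_trans _ _ (t ^+ n.+1 * expR (- t))).
    rewrite mulrAC -exprSr ler_wpM2l ?exprn_ge0 ?(ltW t0) //.
    by rewrite ler_piMr ?expR_ge0 // exprn_ile1.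
  rewrite expRN ler_pdivrMr ?expR_gt0 // -ler_pdivrMl ?ltr0n ?fact_gt0 // mulrC.
  have := @expR_ge1Dxn R t n (ltW t0); lra.
- exact: cvg_cst.
- rewrite -[X in _ --> X](mulr0 n.+1`!%:R); apply: cvgMr.
  apply/gtr0_cvgV0; last exact: cvg_id.
  exact: nbhs_pinfty_gt.
Unshelve. all: by end_near. Qed.

Lemma has_primitive0y_log_moment {R : realType} (n m : nat) :
  has_primitive0y (@log_moment R n m)
    (n`!%:R * (zetaN_star R m.+1 (nseq n 1%N) / m.+1%:R)).
Proof.
elim: n m => [|n IHn] m.
  rewrite fact0 mul1r zetaN_star_nil.
  (* The constant [- 1] makes the primitive vanish at infinity. *)
  exists (fun t => m.+1%:R^-1 * ((1 - expR (- t)) ^+ m.+1 - 1)); split.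
  - move=> t; have d := is_derive_exp m.+1 (is_derive_1BexpRN t).
    have := is_derive_mul (is_derive_cst (m.+1%:R^-1 : R) t 1)
      (is_deriveB d (is_derive_cst (1 : R) t 1)).
    move=> /is_derive_eq; apply.
    rewrite /log_moment expr0 !mul1r mul0r add0r subr0 /= mulrA mulrA mulVf ?mul1r 1?mulrC //.
  - have u1 : 1 - expR (- t) @[t --> +oo] --> (1 : R).
      by rewrite -[X in _ --> X]subr0; apply: cvgB; [exact: cvg_cst | exact: cvgr_expR].
    rewrite -[X in _ --> X](mulr0 m.+1%:R^-1); apply: cvgMr.
    rewrite -[X in _ --> X](subrr 1); apply: cvgB; last exact: cvg_cst.
    rewrite -[X in _ --> X](expr1n R m.+1).
    apply: (@cvg_comp _ _ _ (fun t : R => 1 - expR (- t)) (fun u : R => u ^+ m.+1) _ (nbhs (1 : R)));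
      [exact: u1 | exact: exprn_continuous].
  - by rewrite oppr0 expR0 subrr expr0n /= sub0r mulrN1 mul1r.
(* Integrating [is_derive_log_moment] gives
   [(k + 1) J(n + 1, k) = k J(n + 1, k - 1) + (n + 1) J(n, k)]. *)
have step k v : has_primitive0y (fun t => k%:R * @log_moment R n.+1 k.-1 t) v ->
    has_primitive0y (fun t => k.+1%:R * @log_moment R n.+1 k t)
      (n.+1%:R * (n`!%:R * (zetaN_star R k.+1 (nseq n 1%N) / k.+1%:R)) + v).
  move=> Hv.
  have [F [dF F0 FE]] := has_primitive0yD (has_primitive0yZ n.+1%:R (IHn k)) Hv.
  (* The subtracted [log_moment] vanishes at infinity and, having a factor [t ^+ n.+1], also at 0,
     so it leaves the value of the integral unchanged. *)
  exists (fun t => F t - log_moment n.+1 k t); split.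
  - move=> t; have := is_deriveB (dF t) (is_derive_log_moment n k t).
    by move=> /is_derive_eq; apply; ring.
  - by rewrite -[X in _ --> X](subrr 0); apply: cvgB => //; exact: cvgy_log_moment.
  - by rewrite FE /log_moment expr0n mul0r subr0.
have main k : has_primitive0y (fun t => k.+1%:R * @log_moment R n.+1 k t)
    (n.+1`!%:R * zetaN_star R k.+1 (nseq n.+1 1%N)).
  (* Splitting off the last term of the star sum gives the same recursion as [step]. *)
  have fact_step j : n.+1`!%:R * zetaN_star R j.+1 (nseq n.+1 1%N) =
      n.+1%:R * (n`!%:R * (zetaN_star R j.+1 (nseq n 1%N) / j.+1%:R)) +
      n.+1`!%:R * zetaN_star R j (nseq n.+1 1%N) :> R.
    rewrite /= !zetaN_star_cons big_nat_recr //= factS natrM expr1; ring.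
  elim: k => [|k IHk].
    (* At [k = 0] the previous integrand carries the factor 0, matching the empty star sum with
       bound 0. *)
    rewrite fact_step; apply: step.
    rewrite zetaN_star_cons big_geq // mulr0; under eq_fun do rewrite mul0r.
    exists (cst 0); split; [|exact: cvg_cst|by rewrite oppr0].
    by move=> t; exact: is_derive_cst.
  by rewrite fact_step; exact: step.
have := has_primitive0yZ m.+1%:R^-1 (main m).
have -> : (fun t => m.+1%:R^-1 * (m.+1%:R * log_moment n.+1 m t)) = @log_moment R n.+1 m.
  by apply/funext => t; rewrite mulKf.
by rewrite mulrCA [_^-1 * _]mulrC.
Qed.

(** * The Arakawa-Kaneko function at positive integers *)

Lemma zetaN_star1_ones {R : realType} (n : nat) : zetaN_star R 1 (nseq n 1%N) = 1.
Proof.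
by elim: n => [|n IH]; rewrite ?zetaN_star_nil //= zetaN_star_cons big_nat1 IH divr1.
Qed.

Lemma Gamma_natS {R : realType} (n : nat) : Gamma (n.+1%:R : R) = n`!%:R.
Proof.
rewrite /Gamma /Rintegral.
under eq_integral => t.
  rewrite inE /= in_itv /= andbT => t0.
  rewrite -natr1 addrK powR_mulrn ?ltW //.
  have -> : t ^+ n * expR (- t) = log_moment n 0 t.
    by rewrite /log_moment expr0 mulr1.
  over.
rewrite (integral_has_primitive0y _ _ _ _ (has_primitive0y_log_moment n 0)) /=.
- by rewrite zetaN_star1_ones divr1 mulr1.
- exact: continuous_log_moment.
- exact: log_moment_ge0.
Qed.

Lemma xi_integrand_cvg {R : realType} (k n : nat) (a : seq nat) (t : R) :
  pos_index a -> 0 < t ->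
  \sum_(1 <= j < N.+1) zetaN R j.-1 a / j%:R ^+ k * log_moment n j.-1 t @[N --> \oo] -->
    t `^ (n.+1%:R - 1) / (expR t - 1) * Li (k :: a) (1 - expR (- t)).
Proof.
move=> Ha t0; rewrite -natr1 addrK powR_mulrn ?ltW //.
rewrite (_ : (fun N => _) = (fun N => (t ^+ n / (expR t - 1)) * \sum_(1 <= j < N.+1)
    (1 - expR (- t)) ^+ j * (zetaN R j.-1 a / j%:R ^+ k))).
  by apply: cvgMr; exact: cvg_Li (expRN_itv (ltW t0)).
apply/funext => N; rewrite mulr_sumr [LHS]big_nat [RHS]big_nat.
apply: eq_bigr => -[//|j] _ /=.
(* With [q = expR (- t)], the kernel [1 / (expR t - 1)] is [q / (1 - q)]: it lowers each power of
   [1 - q] by one and supplies the factor [q] of [log_moment]. *)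
have -> : expR t = (expR (- t))^-1 by rewrite expRN invrK.
rewrite /log_moment exprS.
have e2 : 1 - expR (- t) != 0 by rewrite subr_eq0 eq_sym lt_eqF // -expR0 ltr_expR oppr_lt0.
move: e2 (expR_gt0 (- t)) => /[swap]; set q := expR (- t) => q0 e2.
have -> : q^-1 - 1 = (1 - q) / q by rewrite mulrBl mul1r divff // gt_eqF.
rewrite invf_div; set x := _ / _ ^+ k; field.
exact: e2.
Qed.

(* k1 :: ks is the index (k_1, ..., k_r), with r = (size ks).+1 >= 1. *)
Theorem theorem2 (R : realType) (k1 : nat) (ks : seq nat) (n : nat)
    (hk1 : (1 <= k1)%N) (hks : all (leq 1) ks) (hn : (1 <= n)%N) :
  ((fun N : nat => \sum_(1 <= n1 < N.+1)
       zetaN_star R n1 (nseq n.-1 1%N) * zetaN R n1.-1 ks / n1%:R ^+ k1.+1)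
     @ \oo --> xi (k1 :: ks) (n%:R : R))
  /\
  (exists as_ : seq (seq nat),
     all admissible as_ /\
     xi (k1 :: ks) (n%:R : R) = \sum_(a <- as_) zeta R a).
Proof.
case: n hn => [//|n] _ /=; set S := fun N : nat => _.
(* The list is found before [xi] enters: the partial sums have a limit that is a sum of zeta values,
   first entries being [p + k1.+1 >= 2]. Both claims then reduce to identifying [xi] with this
   limit. *)
have [|L [PL SL]] := @cvg_zeta_comb R S.
  apply: (zeta_comb_nested_star _ _ (fun j => zetaN_star R j (nseq n 1%N))
      (fun j => zetaN R j ks)).
  - move=> p a Ha; have h : (1 < p + k1.+1)%N by rewrite addnS ltnS (leq_trans hk1) ?leq_addl.
    by apply/andP; split=> //; apply/andP; split=> //; exact: ltnW.
  - by apply: zeta_comb_star; rewrite /pos_index all_nseq orbT.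
  - exact: zeta_comb_zetaN.
suff xiE : xi (k1 :: ks) (n.+1%:R : R) = \sum_(a <- L) zeta R a.
  by split; [rewrite xiE | exists L].
pose f N t : R := \sum_(1 <= j < N.+1) zetaN R j.-1 ks / j%:R ^+ k1 * log_moment n j.-1 t.
pose I t : R := t `^ (n.+1%:R - 1) / (expR t - 1) * Li (k1 :: ks) (1 - expR (- t)).
pose D := [set` `]0%R, +oo[] : set R.
have D0 t : D t -> 0 < t by rewrite /D /= in_itv /= andbT.
have c0 j : 0 <= zetaN R j.-1 ks / j%:R ^+ k1 :> R.
  by rewrite divr_ge0 ?zetaN_ge0 ?exprn_ge0 ?ler0n.
have cf N : continuous (f N).
  move=> t; apply: cvg_big => [|j _]; first exact: add_continuous.
  by apply: cvgMr; exact: continuous_log_moment.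
have term_ge0 j t : 0 <= t -> 0 <= zetaN R j.-1 ks / j%:R ^+ k1 * log_moment n j.-1 t.
  by move=> t0; rewrite mulr_ge0 // log_moment_ge0.
have f0 N t : 0 <= t -> 0 <= f N t.
  by move=> t0; apply: sumr_ge0 => j _; exact: term_ge0.
(* Termwise integration is exact for the truncations; the [1 / j] from the moment raises the
   exponent [k1] to [k1.+1]. *)
have int_f N : (\int[@lebesgue_measure R]_(t in D) (f N t)%:E =
    (n`!%:R * S N)%:E)%E.
  apply: integral_has_primitive0y => //; first exact: f0.
  have -> : n`!%:R * S N = \sum_(1 <= j < N.+1) zetaN R j.-1 ks / j%:R ^+ k1 *
      (n`!%:R * (zetaN_star R j.-1.+1 (nseq n 1%N) / j.-1.+1%:R)).
    rewrite mulr_sumr [LHS]big_nat [RHS]big_nat; apply: eq_bigr => -[//|j] _ /=.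
    rewrite exprS invfM; ring.
  apply: has_primitive0y_sum => j.
  by apply: has_primitive0yZ; exact: has_primitive0y_log_moment.
have int_I : (\int[@lebesgue_measure R]_(t in D) (I t)%:E =
    (n`!%:R * \sum_(a <- L) zeta R a)%:E)%E.
  have lim_f : (\int[@lebesgue_measure R]_(t in D) (f N t)%:E)%E @[N --> \oo] -->
      (\int[@lebesgue_measure R]_(t in D) limn (fun N => (f N t)%:E))%E.
    apply: cvg_monotone_convergence.
    - exact: measurable_itv.
    - move=> N; apply/measurable_EFinP/measurable_funTS.
      exact: continuous_measurable_fun.
    - by move=> N t /D0/ltW t0; rewrite lee_fin f0.
    - move=> t /D0/ltW t0; apply/nondecreasing_seqP => N; rewrite lee_fin.
      by rewrite /f [leRHS]big_nat_recr //= lerDl; exact: (term_ge0 N.+1).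
  have <- : (\int[@lebesgue_measure R]_(t in D) limn (fun N => (f N t)%:E) =
      \int[@lebesgue_measure R]_(t in D) (I t)%:E)%E.
    apply: eq_integral => t; rewrite inE => /D0 t0; apply: cvg_lim => //.
    by apply: cvg_EFin; [exact: nearW | exact: xi_integrand_cvg].
  (* The integrals of [f N] tend to that of [I] by monotone convergence, and to the multiple of the
     zeta sum by [int_f]. *)
  have := @cvg_unique _ (@ereal_hausdorff R) _ _ _ _ lim_f; apply.
  rewrite /= (funext int_f).
  apply: cvg_EFin; first exact: nearW.
  exact: cvgMr.
rewrite /xi Gamma_natS /Rintegral int_I /= mulrA mulVf ?mul1r //.
Qed.
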